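(* Let $T:l_\infty\to l_\infty$ be a continuous positive linear map with adjoint $T^*$. If a binary relation $\succsim$ on $l_\infty$ satisfies Weak order, Monotonicity, Continuity, ICRP, Convexity and I$T$IS, then there exists a grounded and weak$^\star$-lower semicontinuous function $c:\Delta(T^* )\to[0,\infty]$ such that $$I(x)=\min_{p\in\Delta(T^* )}\{\langle x,p\rangle+c(p)\}$$ is a constant equivalent representing $\succsim$. Conversely, if $\succsim$ is represented by such an $I$ for some grounded weak$^\star$-lower semicontinuous $c:\Delta(T^* )\to[0,\infty]$, and $\langle 1,T^*(p)\rangle\le1$ for every $p\in\Delta(T^* )$, then $\succsim$ satisfies Weak order, Monotonicity, Continuity, ICRP, Convexity and I$T$IS.
   Context: $l_\infty$: real bounded sequences indexed by $\mathbb N$, sup norm; $\theta\in\mathbb R$ also denotes a constant sequence; $x\ge y$ coordinatewise. $ba(\mathbb N)$: norm dual of $l_\infty$ (bounded finitely additive signed measures on $2^{\mathbb N}$), pairing $\langle x,\mu\rangle$, weak$^\star$ topology. Adjoint: $\langle x,T^*(\mu)\rangle=\langle T(x),\mu\rangle$. $\Delta$: finitely additive probability measures on $2^{\mathbb N}$. Eigenvector of $T^*$: nonzero $\mu$ with $T^*(\mu)=\lambda\mu$ for some real $\lambda$; $\Delta(T^* )$ is the set of $p\in\Delta$ that are eigenvectors of $T^*$. Grounded: infimum $0$. A constant equivalent representing $\succsim$ is $I$ with $x\sim I(x)$ and $x\succsim y\iff I(x)\ge I(y)$. Weak order: complete, transitive. Monotonicity: $x\ge y\Rightarrow x\succsim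 y$, and $1\succ0$. Continuity: for $x\succsim y\succsim z$ the sets $\{\alpha\in[0,1]:\alpha x+(1-\alpha)z\succsim y\}$, $\{\alpha\in[0,1]:y\succsim\alpha x+(1-\alpha)z\}$ are closed. ICRP: $x\succsim y\Rightarrow x+\theta\succsim y+\theta$. Convexity: $x\succsim\theta,y\succsim\theta\Rightarrow\lambda x+(1-\lambda)y\succsim\theta$ for $\lambda\in[0,1]$. I$T$IS: for all $x,d\in l_\infty$, $x+d\succsim x$ implies $x+T(d)\succsim x$. *)

(* Defs.v *)
From Stdlib Require Import Reals Lra List.
From Coquelicot Require Import Rbar.
Open Scope R_scope.

Record linf := Linf { lseq :> nat -> R; lbnd : exists M, forall n, Rabs (lseq n) <= M }.

Lemma lc_bnd (a b : R) (x y : linf) :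
  exists M, forall n, Rabs (a * x n + b * y n) <= M.
Proof.
destruct (lbnd x) as [Mx Hx]; destruct (lbnd y) as [My Hy].
exists (Rabs a * Mx + Rabs b * My). intro n.
eapply Rle_trans; [apply Rabs_triang|]. rewrite !Rabs_mult.
apply Rplus_le_compat; apply Rmult_le_compat_l; auto using Rabs_pos.
Qed.

Definition lc (a : R) (x : linf) (b : R) (y : linf) : linf :=
  Linf (fun n => a * x n + b * y n) (lc_bnd a b x y).

Lemma cst_bnd (t : R) : exists M, forall n : nat, Rabs ((fun _ : nat => t) n) <= M.
Proof. exists (Rabs t); intros; simpl; lra. Qed.

Definition cst (t : R) : linf := Linf (fun _ => t) (cst_bnd t).

Definition ladd (x y : linf) : linf := lc 1 x 1 y.

Definition lge (x y : linf) : Prop := forall n, y n <= x n.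

Lemma ind_bnd (A : nat -> bool) :
  exists M, forall n, Rabs ((fun n => if A n then 1 else 0) n) <= M.
Proof.
exists 1; intro n; simpl; destruct (A n); [rewrite Rabs_R1 | rewrite Rabs_R0]; lra.
Qed.
Definition ind (A : nat -> bool) : linf := Linf (fun n => if A n then 1 else 0) (ind_bnd A).

Definition linear_map (T : linf -> linf) : Prop :=
  forall a b x y n, T (lc a x b y) n = a * T x n + b * T y n.

Definition cont_map (T : linf -> linf) : Prop :=
  forall (x : linf) (eps : R), 0 < eps -> exists delta : R, 0 < delta /\
    forall y : linf, (forall n : nat, Rabs (y n - x n) <= delta) ->
      forall n, Rabs (T y n - T x n) <= eps.

Definition positive_map (T : linf -> linf) : Prop :=
  forall x, lge x (cst 0) -> lge (T x) (cst 0).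

(* ---------- ba(N) = norm dual of l_inf; pairing <x,mu> = mu x ---------- *)
Definition linear_fun (f : linf -> R) : Prop :=
  forall a b x y, f (lc a x b y) = a * f x + b * f y.

Definition cont_fun (f : linf -> R) : Prop :=
  forall (x : linf) (eps : R), 0 < eps -> exists delta : R, 0 < delta /\
    forall y : linf, (forall n : nat, Rabs (y n - x n) <= delta) -> Rabs (f y - f x) <= eps.

Definition in_ba (mu : linf -> R) : Prop := linear_fun mu /\ cont_fun mu.

(* Delta: finitely additive probability measures (mu(A) = <1_A, mu>) *)
Definition in_Delta (p : linf -> R) : Prop :=
  in_ba p /\ (forall A, 0 <= p (ind A)) /\ p (ind (fun _ => true)) = 1.

Definition adj (T : linf -> linf) (mu : linf -> R) : linf -> R := fun x => mu (T x).

Definition eigvec (T : linf -> linf) (mu : linf -> R) : Prop :=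
  in_ba mu /\ (exists x, mu x <> 0) /\
  exists lam : R, forall x, adj T mu x = lam * mu x.

Definition DeltaT (T : linf -> linf) (p : linf -> R) : Prop :=
  in_Delta p /\ eigvec T p.

(* ---------- the cost function c : Delta(T^star) -> [0,+oo] ----------
   c is given as a function on all functionals; only its values on
   Delta(T^star) matter. *)
Definition nonneg_on (T : linf -> linf) (c : (linf -> R) -> Rbar) : Prop :=
  forall p, DeltaT T p -> Rbar_le (Finite 0) (c p).

Definition grounded (T : linf -> linf) (c : (linf -> R) -> Rbar) : Prop :=
  (forall p, DeltaT T p -> Rbar_le (Finite 0) (c p)) /\
  (forall eps, 0 < eps -> exists p, DeltaT T p /\ Rbar_lt (c p) (Finite eps)).

Definition wnbhd (p : linf -> R) (xs : list linf) (eps : R) (q : linf -> R) : Prop :=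
  Forall (fun x => Rabs (q x - p x) < eps) xs.

Definition wlsc_on (T : linf -> linf) (c : (linf -> R) -> Rbar) : Prop :=
  forall p, DeltaT T p -> forall t : R, Rbar_lt (Finite t) (c p) ->
    exists xs eps, 0 < eps /\
      forall q, DeltaT T q -> wnbhd p xs eps q -> Rbar_lt (Finite t) (c q).

Definition min_rep (T : linf -> linf) (c : (linf -> R) -> Rbar) (I : linf -> R) : Prop :=
  forall x,
    (exists p, DeltaT T p /\ Rbar_plus (Finite (p x)) (c p) = Finite (I x)) /\
    (forall p, DeltaT T p -> Rbar_le (Finite (I x)) (Rbar_plus (Finite (p x)) (c p))).

Definition const_equiv (pref : linf -> linf -> Prop) (I : linf -> R) : Prop :=
  (forall x, pref x (cst (I x)) /\ pref (cst (I x)) x) /\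
  (forall x y, pref x y <-> I x >= I y).

Definition weak_order (pref : linf -> linf -> Prop) : Prop :=
  (forall x y, pref x y \/ pref y x) /\
  (forall x y z, pref x y -> pref y z -> pref x z).

Definition monotonicity (pref : linf -> linf -> Prop) : Prop :=
  (forall x y, lge x y -> pref x y) /\
  (pref (cst 1) (cst 0) /\ ~ pref (cst 0) (cst 1)).

Definition continuity (pref : linf -> linf -> Prop) : Prop :=
  forall x y z, pref x y -> pref y z ->
    closed_set (fun a => 0 <= a <= 1 /\ pref (lc a x (1 - a) z) y) /\
    closed_set (fun a => 0 <= a <= 1 /\ pref y (lc a x (1 - a) z)).

Definition icrp (pref : linf -> linf -> Prop) : Prop :=
  forall x y (t : R), pref x y -> pref (ladd x (cst t)) (ladd y (cst t)).

Definition convexity (pref : linf -> linf -> Prop) : Prop :=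
  forall x y (t l : R), pref x (cst t) -> pref y (cst t) -> 0 <= l <= 1 ->
    pref (lc l x (1 - l) y) (cst t).

Definition itis (T : linf -> linf) (pref : linf -> linf -> Prop) : Prop :=
  forall x d, pref (ladd x d) x -> pref (ladd x (T d)) x.

Definition all_axioms (T : linf -> linf) (pref : linf -> linf -> Prop) : Prop :=
  weak_order pref /\ monotonicity pref /\ continuity pref /\
  icrp pref /\ convexity pref /\ itis T pref.

(* Main.v *)
(* A relation satisfying the axioms has a concave niveloid [I] as constant equivalent,
   and ITIS passes to the directional derivative [f] of [I] at [x]: [f d >= 0] implies
   [f (T d) >= 0].  Let [l] be the infimum of the reals [r] such that
   [f (r e - T e) > 0] for some [e] with [f e >= 0].  A Krein-Rutman type argument shows
   [f (T d - l d) <= 0] for every [d], so by Hahn-Banach some linear [p >= f] vanishes on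
   the range of [T - l].  Such a [p] is a supergradient of [I] at [x] and an eigenvector
   of the adjoint of [T]; hence the conjugate of [I], restricted to eigenvectors,
   already represents [I].  Conversely, if [p] is an eigenvector with eigenvalue in
   [[0, 1]], then [p (x + T d)] is a mixture of [p (x + d)] and [p x], which gives ITIS. *)

From mathcomp Require boolp classical_sets.
From Stdlib Require Import Reals Lra.
From Stdlib Require Import Classical ProofIrrelevance FunctionalExtensionality.
From Coquelicot Require Import Rbar Lub.
Require Import Defs.
Open Scope R_scope.

(** * Bounded sequences and suprema of sets of reals *)

Lemma linf_ext (x y : linf) : (forall n, x n = y n) -> x = y.
Proof.
destruct x as [x Hx], y as [y Hy]; simpl; intro H.
apply functional_extensionality in H; subst y.
f_equal; apply proof_irrelevance.
Qed.

Ltac linf_eq := apply linf_ext; intro; simpl; field; try lra.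

Lemma linf_bound (x : linf) : exists M, 0 < M /\ forall n, - M <= x n <= M.
Proof.
destruct (lbnd x) as [M HM]; exists (Rabs M + 1); split.
- pose proof (Rabs_pos M); lra.
- intro n; specialize (HM n); pose proof (Rle_abs M).
  pose proof (Rle_abs (x n)); pose proof (Rle_abs (- x n)).
  rewrite Rabs_Ropp in *; lra.
Qed.

Lemma linear_map_lc T a b x y : linear_map T -> T (lc a x b y) = lc a (T x) b (T y).
Proof. intro H; apply linf_ext; intro n; apply H. Qed.

(** [real] sends an infinite bound to [0], so the value is meaningful only for nonempty sets that
    are bounded above. *)
Definition Sup (E : R -> Prop) : R := real (Lub_Rbar E).

Lemma Sup_lub E :
  (exists r, E r) -> (exists M, forall r, E r -> r <= M) -> is_lub E (Sup E).
Proof.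
intros [r0 Hr0] [M HM]; unfold Sup.
destruct (Lub_Rbar_correct E) as [ub least].
assert (HMb : Rbar_le (Lub_Rbar E) M) by (apply least; intros r Hr; apply HM, Hr).
pose proof (ub r0 Hr0) as H0.
destruct (Lub_Rbar E) as [u| |]; simpl in *; try easy.
split.
- intros r Hr; exact (ub r Hr).
- intros b Hb; apply (least (Finite b)); intros r Hr; apply Hb, Hr.
Qed.

(** Dividing by [a] turns [M] into an upper bound of [E]. Nonemptiness settles the case [a = 0]. *)
Lemma is_lub_affine_le E u a k M :
  is_lub E u -> (exists r, E r) -> 0 <= a ->
  (forall r, E r -> a * r + k <= M) -> a * u + k <= M.
Proof.
intros [_ least] [r0 H0] Ha H.
destruct (Rle_lt_or_eq_dec 0 a Ha) as [Ha'|<-].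
- assert (u <= (M - k) / a).
  { apply least; intros r Hr; specialize (H r Hr).
    apply Rmult_le_reg_l with a; [easy|]. field_simplify; lra. }
  apply Rmult_le_compat_l with (r := a) in H1; [|easy].
  replace (a * ((M - k) / a)) with (M - k) in H1 by (field; lra). lra.
- specialize (H r0 H0); lra.
Qed.

Lemma archimed_nat a b : 0 < a -> exists n, b < INR n * a.
Proof.
intro Ha; destruct (INR_unbounded (b / a)) as [n Hn]; exists n.
apply Rmult_lt_compat_r with (r := a) in Hn; [|easy].
unfold Rdiv in Hn; rewrite Rmult_assoc, Rinv_l in Hn; lra.
Qed.

(** * Superlinear functionals and the Hahn-Banach theorem *)

(** Superadditivity and positive homogeneity in a single inequality; equality in the homogeneity
    follows by using it with both [a] and [/ a]. *)
Definition superlinear (f : linf -> R) : Prop :=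
  forall a b x y, 0 <= a -> 0 <= b -> a * f x + b * f y <= f (lc a x b y).

(** Describing [z] coordinatewise reduces each later use to a ring identity between reals. *)
Lemma superlinear_le f a b (x y z : linf) :
  superlinear f -> 0 <= a -> 0 <= b -> (forall n, z n = a * x n + b * y n) ->
  a * f x + b * f y <= f z.
Proof.
intros Hf Ha Hb Hz; replace z with (lc a x b y) by (apply linf_ext; intro; symmetry; apply Hz).
now apply Hf.
Qed.

Lemma superlinear0 f (z : linf) : superlinear f -> (forall n, z n = 0) -> f z = 0.
Proof.
intros Hf Hz.
(* The first instance gives [2 * f z <= f z], the second [0 <= f z]. *)
pose proof (superlinear_le f 2 0 z z z Hf).
pose proof (superlinear_le f 0 0 z z z Hf).
cut (forall a b n, z n = a * z n + b * z n).
- intro E; specialize (H ltac:(lra) ltac:(lra) (E _ _)).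
  specialize (H0 ltac:(lra) ltac:(lra) (E _ _)); lra.
- intros; rewrite Hz; ring.
Qed.

Lemma superlinear_scal f a (x z : linf) :
  superlinear f -> 0 <= a -> (forall n, z n = a * x n) -> f z = a * f x.
Proof.
intros Hf Ha Hz.
destruct (Rle_lt_or_eq_dec 0 a Ha) as [Ha'|<-].
- apply Rle_antisym.
  + assert (Hi : 0 < / a) by now apply Rinv_0_lt_compat.
    pose proof (superlinear_le f (/ a) 0 z z x Hf ltac:(lra) ltac:(lra)) as H.
    assert (H' : / a * f z <= f x).
    { enough (/ a * f z + 0 * f z <= f x) by lra; apply H; intro n; rewrite Hz; field; lra. }
    apply Rmult_le_compat_l with (r := a) in H'; [|lra].
    rewrite <- Rmult_assoc, Rinv_r in H'; lra.
  + pose proof (superlinear_le f a 0 x x z Hf ltac:(lra) ltac:(lra)) as H.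
    enough (a * f x + 0 * f x <= f z) by lra; apply H; intro n; rewrite Hz; ring.
- rewrite Rmult_0_l; apply superlinear0; [easy|]; intro n; rewrite Hz; ring.
Qed.

Lemma superlinear_opp f (x z : linf) :
  superlinear f -> (forall n, z n = - x n) -> f x <= - f z.
Proof.
intros Hf Hz.
assert (H : 1 * f x + 1 * f z <= f (cst 0)).
{ apply superlinear_le; try easy; try lra; intro n; simpl; rewrite Hz; ring. }
rewrite (superlinear0 f (cst 0)) in H; [lra|easy|easy].
Qed.

(** [E x] collects candidate values at [x]. A combination of candidates is dominated by a candidate,
    so the suprema over [r] and [s] can be taken one after the other. *)
Lemma superlinear_Sup (E : linf -> R -> Prop) :
  (forall x, exists r, E x r) -> (forall x, exists M, forall r, E x r -> r <= M) ->
  (forall a b x y r s, 0 <= a -> 0 <= b -> E x r -> E y s ->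
     exists u, E (lc a x b y) u /\ a * r + b * s <= u) ->
  superlinear (fun x => Sup (E x)).
Proof.
intros E0 EM EC a b x y Ha Hb.
apply (is_lub_affine_le (E x)); auto using Sup_lub.
intros r Hr; rewrite Rplus_comm.
apply (is_lub_affine_le (E y)); auto using Sup_lub.
intros s Hs; rewrite Rplus_comm.
destruct (EC a b x y r s Ha Hb Hr Hs) as (u & Hu & Hle).
apply Rle_trans with u; [easy|]. now apply (Sup_lub (E (lc a x b y))).
Qed.

Lemma Sup_ge E r M : E r -> (forall r, E r -> r <= M) -> r <= Sup E.
Proof. intros Hr HM; apply (Sup_lub E); eauto. Qed.

(** Common tool for enlarging [f]: along a direction, along a chain, and modulo the range of a
    linear map. The bound [- f (- x)] limits every superlinear majorant of [f] at [x], and here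
    keeps the supremum finite. *)
Lemma superlinear_relax f (E : linf -> R -> Prop) :
  superlinear f -> (forall x, E x (f x)) ->
  (forall x r, E x r -> r <= - f (lc (-1) x 0 x)) ->
  (forall a b x y r s, 0 <= a -> 0 <= b -> E x r -> E y s ->
     exists u, E (lc a x b y) u /\ a * r + b * s <= u) ->
  exists q, superlinear q /\ forall x r, E x r -> r <= q x.
Proof.
intros Hf E0 EM EC; exists (fun x => Sup (E x)); split.
- apply superlinear_Sup; eauto.
- intros x r Hr; eapply Sup_ge; eauto.
Qed.

Lemma superlinear_additive_linear f :
  superlinear f -> (forall x y, f (ladd x y) <= f x + f y) -> linear_fun f.
Proof.
intros Hf Hadd.
assert (Hopp : forall x z : linf, (forall n, z n = - x n) -> f z = - f x).
{ intros x z Hz; apply Rle_antisym.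
  - enough (f x <= - f z) by lra; now apply superlinear_opp.
  - specialize (Hadd x z); rewrite (superlinear0 f (ladd x z)) in Hadd; try easy; [lra|].
    intro n; simpl; rewrite Hz; ring. }
assert (Hscal : forall a x, f (lc a x 0 x) = a * f x).
{ intros a x; destruct (Rle_dec 0 a) as [Ha|Ha].
  - apply superlinear_scal; auto; intro n; simpl; ring.
  - rewrite (Hopp (lc (- a) x 0 x)) by (intro n; simpl; ring).
    rewrite (superlinear_scal f (- a) x); auto; [ring|lra|intro n; simpl; ring]. }
intros a b x y; rewrite <- (Hscal a x), <- (Hscal b y).
apply Rle_antisym.
- replace (lc a x b y) with (ladd (lc a x 0 x) (lc b y 0 y)) by linf_eq. apply Hadd.
- rewrite <- (Rmult_1_l (f (lc a x 0 x))), <- (Rmult_1_l (f (lc b y 0 y))).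
  apply superlinear_le; auto; try lra; intro n; simpl; ring.
Qed.

(** Failure of additivity at [x0] and [y] would let [f] be enlarged: the majorant built below is at
    least [f (x0 + y) - f y] at [x0], by taking [t = 1]. *)
Lemma maximal_superlinear_linear f :
  superlinear f ->
  (forall g, superlinear g -> (forall x, f x <= g x) -> forall x, g x <= f x) ->
  linear_fun f.
Proof.
intros Hf Hmax; apply superlinear_additive_linear; auto; intros x0 y.
(* The functional [x |-> sup_(t >= 0) f (x + t y) - t f y] is superlinear and dominates [f]. *)
destruct (superlinear_relax f
  (fun x r => exists t, 0 <= t /\ r = f (lc 1 x t y) - t * f y)) as (g & Hg & Hfg); auto.
- intro x; exists 0; split; [lra|].
  replace (lc 1 x 0 y) with x by linf_eq. ring.
- intros x r (t & Ht & ->).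
  assert (H : 1 * f (lc 1 x t y) + 1 * f (lc (-1) x 0 x) <= f (lc t y 0 y)).
  { apply superlinear_le; auto; try lra; intro n; simpl; ring. }
  rewrite (superlinear_scal f t y (lc t y 0 y)) in H; auto; [lra|intro n; simpl; ring].
- intros a b x x' r s Ha Hb (t & Ht & ->) (t' & Ht' & ->).
  exists (f (lc 1 (lc a x b x') (a * t + b * t') y) - (a * t + b * t') * f y).
  split; [exists (a * t + b * t'); split; auto; nra|].
  assert (H : a * f (lc 1 x t y) + b * f (lc 1 x' t' y)
              <= f (lc 1 (lc a x b x') (a * t + b * t') y)).
  { apply superlinear_le; auto; intro n; simpl; ring. }
  lra.
- assert (Hle : forall x, f x <= g x).
  { intro x; apply Hfg; exists 0; split; [lra|].
    replace (lc 1 x 0 y) with x by linf_eq. ring. }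
  specialize (Hmax g Hg Hle x0).
  assert (f (lc 1 x0 1 y) - 1 * f y <= g x0) by (apply Hfg; exists 1; split; [lra|easy]).
  unfold ladd; lra.
Qed.

(** Zorn's lemma on the superlinear majorants of [f], ordered pointwise; a maximal one is linear. *)
Lemma hahn_banach f :
  superlinear f -> exists p, linear_fun p /\ forall x, f x <= p x.
Proof.
intro Hf.
pose (X := {g : linf -> R | superlinear g /\ forall x, f x <= g x}).
pose (le := fun g h : X => boolp.asbool (forall x, proj1_sig g x <= proj1_sig h x)).
assert (leP : forall g h, is_true (le g h) <-> forall x, proj1_sig g x <= proj1_sig h x).
{ intros g h; split; [exact (@boolp.asboolW _)|exact (@boolp.asboolT _)]. }
assert (f0 : X) by (exists f; split; [easy|intro; lra]).
destruct (classical_sets.ZL_preorder f0 (R := le)) as [[p [Hp Hfp]] Hmax].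
- intro g; apply leP; intro; lra.
- intros g h k Hgh Hhk; apply leP; intro x.
  rewrite leP in Hgh, Hhk. specialize (Hgh x); specialize (Hhk x); lra.
- intros A Htot.
  (* The empty chain is bounded by [f] itself, any other by its pointwise supremum. *)
  destruct (classic (exists g, A g)) as [[g0 Hg0]|HA];
    [|exists f0; intros g Hg; destruct HA; now exists g].
  destruct (superlinear_relax (proj1_sig g0)
    (fun x r => exists g, A g /\ r = proj1_sig g x)) as (q & Hq & Hle).
  + apply (proj2_sig g0).
  + intro x; now exists g0.
  + intros x r (g & Hg & ->).
    assert (E : forall n, lc (-1) x 0 x n = - x n) by (intro n; simpl; ring).
    destruct (Htot g g0 Hg Hg0) as [H|H]; rewrite leP in H.
    * apply Rle_trans with (proj1_sig g0 x); [apply H|].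
      apply superlinear_opp; [apply (proj2_sig g0)|easy].
    * apply Rle_trans with (- proj1_sig g (lc (-1) x 0 x)).
      -- apply superlinear_opp; [apply (proj2_sig g)|easy].
      -- apply Ropp_le_contravar, H.
  + intros a b x y r s Ha Hb (g & Hg & ->) (h & Hh & ->).
    destruct (Htot g h Hg Hh) as [H|H]; rewrite leP in H.
    * exists (proj1_sig h (lc a x b y)); split; [now exists h|].
      apply Rle_trans with (a * proj1_sig h x + b * proj1_sig h y).
      -- specialize (H x); nra.
      -- now apply (proj1 (proj2_sig h)).
    * exists (proj1_sig g (lc a x b y)); split; [now exists g|].
      apply Rle_trans with (a * proj1_sig g x + b * proj1_sig g y).
      -- specialize (H y); nra.
      -- now apply (proj1 (proj2_sig g)).
  + assert (Hfq : forall x, f x <= q x).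
    { intro x; apply Rle_trans with (proj1_sig g0 x); [apply (proj2_sig g0)|].
      apply Hle; now exists g0. }
    exists (exist _ q (conj Hq Hfq)); intros g Hg; apply leP; intro x; simpl.
    apply Hle; now exists g.
- exists p; split; [|easy].
  apply maximal_superlinear_linear; [easy|]; intros g Hg Hpg.
  assert (Hfg : forall x, f x <= g x) by (intro x; eapply Rle_trans; [apply Hfp|apply Hpg]).
  specialize (Hmax (exist _ g (conj Hg Hfg))). simpl in Hmax.
  rewrite !leP in Hmax; exact (Hmax Hpg).
Qed.

(** Any linear majorant of [x |-> sup_e f (x + K e)] works: it is nonnegative at both [K e] and
    [K (- e)], hence zero there. The supremum is finite because
    [f (x + K e) + f (- x) <= f (K e) <= 0]. *)
Lemma hahn_banach_annihilator f K :
  superlinear f -> linear_map K -> (forall e, f (K e) <= 0) ->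
  exists p, linear_fun p /\ (forall x, f x <= p x) /\ forall e, p (K e) = 0.
Proof.
intros Hf HK HfK.
destruct (superlinear_relax f (fun x r => exists e, r = f (ladd x (K e))))
  as (q & Hq & Hle); auto.
- intro x; exists (cst 0); f_equal; apply linf_ext; intro n.
  replace (cst 0) with (lc 0 (cst 0) 0 (cst 0)) by linf_eq.
  rewrite (linear_map_lc K) by easy; simpl; ring.
- intros x r (e & ->).
  assert (1 * f (ladd x (K e)) + 1 * f (lc (-1) x 0 x) <= f (K e)).
  { apply superlinear_le; auto; try lra; intro n; simpl; ring. }
  specialize (HfK e); lra.
- intros a b x y r s Ha Hb (e & ->) (e' & ->).
  exists (f (ladd (lc a x b y) (K (lc a e b e')))); split; [now exists (lc a e b e')|].
  rewrite (linear_map_lc K) by easy.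
  apply superlinear_le; auto; intro n; simpl; ring.
- destruct (hahn_banach q Hq) as (p & Hp & Hqp).
  assert (Hfp : forall x e, f (ladd x (K e)) <= p x).
  { intros x e; eapply Rle_trans; [|apply Hqp]; apply Hle; now exists e. }
  exists p; split; [easy|].
  assert (HK0 : forall e, 0 <= p (K e)).
  { intro e; rewrite <- (superlinear0 f (cst 0)) by easy.
    replace (cst 0) with (ladd (K e) (K (lc (-1) e 0 e))); [apply Hfp|].
    rewrite (linear_map_lc K) by easy; linf_eq. }
  split.
  + intro x; replace x with (ladd x (K (lc 0 x 0 x))) at 1; [apply Hfp|].
    rewrite (linear_map_lc K) by easy; linf_eq.
  + intro e; apply Rle_antisym; [|apply HK0].
    specialize (HK0 (lc (-1) e 0 e)).
    rewrite (linear_map_lc K), Hp in HK0 by easy; lra.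
Qed.

(** * Eigenvalues of superlinear functionals *)

(** For a linear functional this amounts to positivity together with the value 1 on the constant 1,
    so it is the trace of [in_Delta] on superlinear functionals. *)
Definition above_inf (f : linf -> R) : Prop :=
  forall (d : linf) m, (forall n, m <= d n) -> m <= f d.

Lemma superlinear_perturb f (d v : linf) :
  superlinear f -> above_inf f ->
  exists N, 0 < N /\ forall s (z : linf), (forall n, z n = d n + s * v n) -> f d - Rabs s * N <= f z.
Proof.
intros Hf Hinf; destruct (linf_bound v) as (N & HN & Hv); exists N; split; [easy|].
intros s z Hz.
assert (H : - (Rabs s * N) <= f (lc s v 0 v)).
{ apply Hinf; intro n; simpl; specialize (Hv n).
  unfold Rabs; destruct (Rcase_abs s); nra. }
assert (1 * f d + 1 * f (lc s v 0 v) <= f z); [|lra].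
apply superlinear_le; auto; try lra; intro n; simpl; rewrite Hz; ring.
Qed.

Lemma superlinear_perturb_pos f (d v : linf) :
  superlinear f -> above_inf f -> 0 < f d ->
  exists delta, 0 < delta /\
    forall s (z : linf), Rabs s <= delta -> (forall n, z n = d n + s * v n) -> 0 < f z.
Proof.
intros Hf Hinf Hd.
destruct (superlinear_perturb f d v Hf Hinf) as (N & HN & H).
exists (f d / (2 * N)); split; [apply Rdiv_lt_0_compat; lra|].
intros s z Hs Hz; specialize (H s z Hz).
apply Rmult_le_compat_r with (r := N) in Hs; [|lra].
replace (f d / (2 * N) * N) with (f d / 2) in Hs by (field; lra). lra.
Qed.

(** Suppose [f (T d - l d) > 0] for [l] the infimum of [B]. This persists for some [l'] in [B]
    slightly above or equal to [l]. With [e] its witness, [f] stays nonnegative arbitrarily far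
    along the ray [e - s d], which forces [f (- d) >= 0]; but then [- d] would put a number below
    [l] into [B]. *)
Lemma superlinear_eigenvalue T f :
  linear_map T -> superlinear f -> above_inf f ->
  (forall d, 0 <= f d -> 0 <= f (T d)) ->
  exists l, forall d, f (lc 1 (T d) (- l) d) <= 0.
Proof.
intros HT Hf Hinf HfT.
pose (B := fun l => exists e, 0 <= f e /\ 0 < f (lc l e (-1) (T e))).
assert (Bpos : forall l, B l -> 0 < l).
{ intros l (e & He & Hle); apply Rnot_le_lt; intro Hl.
  assert (H : (- l) * f e + 1 * f (T e) <= f (lc (- l) e 1 (T e))).
  { apply superlinear_le; auto; lra. }
  pose proof (superlinear_opp f (lc l e (-1) (T e)) (lc (- l) e 1 (T e)) Hf) as H'.
  specialize (HfT e He). enough (f (lc l e (-1) (T e)) <= - f (lc (- l) e 1 (T e))) by nra.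
  apply H'; intro n; simpl; ring. }
(* Suprema of the negatives: [- u] is the infimum of [B]. *)
destruct (completeness (fun r => B (- r))) as [u [Hub Hlub]].
{ exists 0; intros r Hr; apply Bpos in Hr; lra. }
(* [M + 1] belongs to [B] with witness 1, since [(M + 1) - T 1 >= 1]. *)
{ destruct (linf_bound (T (cst 1))) as (M & HM & HTM).
  exists (- (M + 1)); exists (cst 1); rewrite Ropp_involutive; split.
  - apply Rle_trans with 1; [lra|]; apply Hinf; intro n; simpl; lra.
  - apply Rlt_le_trans with 1; [lra|]; apply Hinf; intro n; simpl.
    specialize (HTM n); lra. }
exists (- u); intro d; rewrite Ropp_involutive; apply Rnot_lt_le; intro Hd.
assert (Hlow : forall l, B l -> - u <= l).
{ intros l Hl; enough (- l <= u) by lra; apply Hub; now rewrite Ropp_involutive. }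
(* [-d] would witness that [-u] belongs to [B], which is open. *)
assert (Hnd : f (lc (-1) d 0 d) < 0).
{ apply Rnot_le_lt; intro Hnd.
  destruct (superlinear_perturb_pos f (lc 1 (T d) u d) d Hf Hinf Hd) as (delta & Hdelta & H).
  specialize (H delta (lc (- u - delta) (lc (-1) d 0 d) (-1) (T (lc (-1) d 0 d)))).
  assert (HB : B (- u - delta)).
  { exists (lc (-1) d 0 d); split; [easy|]; apply H.
    - rewrite Rabs_right; lra.
    - intro n; simpl; rewrite HT; ring. }
  apply Hlow in HB; lra. }
destruct (superlinear_perturb_pos f (lc 1 (T d) u d) d Hf Hinf Hd) as (delta & Hdelta & H).
assert (exists l, B l /\ l < - u + delta) as (l & Hl & Hlu).
{ apply NNPP; intro Hno. enough (u <= u - delta) by lra.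
  apply Hlub; intros r Hr. apply Rnot_lt_le; intro Hr'. apply Hno; exists (- r); split; [easy|lra]. }
pose proof (Hlow l Hl) as Hul; pose proof (Bpos l Hl) as Hl0.
assert (Hdl : 0 < f (lc 1 (T d) (- l) d)).
{ apply (H (- u - l)); [rewrite Rabs_left1; lra|intro n; simpl; ring]. }
destruct Hl as (e & He & Hle).
set (g := f (lc l e (-1) (T e))) in *.
destruct (linf_bound d) as (M & HM & HdM).
(* [f (e - s d) >= 0] forces [f (e - s d) >= g / l], hence propagates from [s] to
   [s + g / (l M)], and so to arbitrarily large [s]. *)
set (h := g / (l * M)).
assert (Hh : 0 < h) by (apply Rdiv_lt_0_compat; [easy|nra]).
assert (Hstep : forall s, 0 <= s -> 0 <= f (lc 1 e (- s) d) -> 0 <= f (lc 1 e (- (s + h)) d)).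
{ intros s Hs Hfs.
  assert (H1 : 1 * g + 1 * f (T (lc 1 e (- s) d))
               <= f (ladd (lc l e (-1) (T e)) (T (lc 1 e (- s) d)))).
  { apply superlinear_le; auto; try lra; intro n; simpl; ring. }
  assert (H2 : 1 * f (ladd (lc l e (-1) (T e)) (T (lc 1 e (- s) d)))
               + s * f (lc 1 (T d) (- l) d) <= f (lc l (lc 1 e (- s) d) 0 e)).
  { apply superlinear_le; auto; try lra; intro n; simpl; rewrite HT; ring. }
  rewrite (superlinear_scal f l (lc 1 e (- s) d) (lc l (lc 1 e (- s) d) 0 e)) in H2;
    [|easy|lra|intro n; simpl; ring].
  assert (H3 : g / l <= f (lc 1 e (- s) d)).
  { apply Rmult_le_reg_l with l; [easy|].
    replace (l * (g / l)) with g by (field; lra).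
    specialize (HfT _ Hfs). nra. }
  assert (H4 : - (h * M) <= f (lc (- h) d 0 d)).
  { apply Hinf; intro n; simpl; specialize (HdM n); nra. }
  replace (h * M) with (g / l) in H4 by (unfold h; field; lra).
  assert (1 * f (lc 1 e (- s) d) + 1 * f (lc (- h) d 0 d) <= f (lc 1 e (- (s + h)) d)); [|lra].
  apply superlinear_le; auto; try lra; intro n; simpl; ring. }
assert (Hall : forall k, 0 <= f (lc 1 e (- (INR k * h)) d)).
{ induction k as [|k IH].
  - replace (lc 1 e (- (INR 0 * h)) d) with e; [easy|linf_eq].
  - rewrite S_INR, Rmult_plus_distr_r, Rmult_1_l; apply Hstep; [|easy].
    pose proof (pos_INR k); nra. }
(* Superadditivity gives [f (- e) <= k h f (- d)] for every [k], impossible for large [k] because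
   [f (- d) < 0]. *)
destruct (archimed_nat (h * (- f (lc (-1) d 0 d))) (- f (lc (-1) e 0 e))) as [k Hk]; [nra|].
assert (1 * f (lc 1 e (- (INR k * h)) d) + 1 * f (lc (-1) e 0 e)
        <= f (lc (INR k * h) (lc (-1) d 0 d) 0 d)) as H5.
{ apply superlinear_le; auto; try lra; intro n; simpl; ring. }
rewrite (superlinear_scal f (INR k * h) (lc (-1) d 0 d)
  (lc (INR k * h) (lc (-1) d 0 d) 0 d)) in H5.
- specialize (Hall k); lra.
- easy.
- pose proof (pos_INR k); nra.
- intro n; simpl; ring.
Qed.

(** * Concave niveloids *)

Definition concave_niveloid (I : linf -> R) : Prop :=
  (forall x y, lge x y -> I y <= I x) /\
  (forall x t, I (ladd x (cst t)) = I x + t) /\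
  (forall l x y, 0 <= l <= 1 -> l * I x + (1 - l) * I y <= I (lc l x (1 - l) y)).

(** [itis] read through a constant equivalent. *)
Definition improving (T : linf -> linf) (I : linf -> R) : Prop :=
  forall x d, I x <= I (ladd x d) -> I x <= I (ladd x (T d)).

Lemma niveloid_le I (x y : linf) t :
  concave_niveloid I -> (forall n, y n <= x n + t) -> I y <= I x + t.
Proof.
intros (Hm & Ht & _) H; rewrite <- Ht; apply Hm; intro n; simpl.
specialize (H n); lra.
Qed.

Lemma niveloid_concave I a b (x y z : linf) :
  concave_niveloid I -> 0 <= a -> 0 <= b -> a + b = 1 ->
  (forall n, z n = a * x n + b * y n) -> a * I x + b * I y <= I z.
Proof.
intros (_ & _ & Hc) Ha Hb Hab Hz; replace b with (1 - a) in * by lra.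
replace z with (lc a x (1 - a) y) by (apply linf_ext; intro; symmetry; apply Hz).
apply Hc; lra.
Qed.

(** For concave [I] the difference quotients decrease in [t], so this supremum is the one-sided
    directional derivative at [t = 0]. *)
Definition dirder (I : linf -> R) (x d : linf) : R :=
  Sup (fun r => exists t, 0 < t /\ r = (I (lc 1 x t d) - I x) / t).

Lemma dirder_quotient_le I x (d : linf) M t :
  concave_niveloid I -> (forall n, d n <= M) -> 0 < t ->
  (I (lc 1 x t d) - I x) / t <= M.
Proof.
intros HI Hd Ht; apply Rmult_le_reg_l with t; [easy|].
replace (t * ((I (lc 1 x t d) - I x) / t)) with (I (lc 1 x t d) - I x) by (field; lra).
enough (I (lc 1 x t d) <= I x + t * M) by lra.
apply niveloid_le; [easy|]; intro n; simpl; specialize (Hd n); nra.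
Qed.

Lemma dirder_lub I x d :
  concave_niveloid I ->
  is_lub (fun r => exists t, 0 < t /\ r = (I (lc 1 x t d) - I x) / t) (dirder I x d).
Proof.
intro HI; apply Sup_lub.
- exists ((I (lc 1 x 1 d) - I x) / 1), 1; split; [lra|easy].
- destruct (linf_bound d) as (M & _ & HM); exists M; intros r (t & Ht & ->).
  apply dirder_quotient_le; try easy; intro n; apply HM.
Qed.

Lemma dirder_ge I x d t :
  concave_niveloid I -> 0 < t -> I (lc 1 x t d) - I x <= t * dirder I x d.
Proof.
intros HI Ht; apply Rmult_le_reg_l with (/ t); [now apply Rinv_0_lt_compat|].
replace (/ t * (t * dirder I x d)) with (dirder I x d) by (field; lra).
apply (dirder_lub I x d HI); exists t; split; [easy|]; field; lra.
Qed.

Lemma dirder_pos I x d :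
  concave_niveloid I -> 0 < dirder I x d -> exists t, 0 < t /\ I x < I (lc 1 x t d).
Proof.
intros HI Hd; apply NNPP; intro Hno.
enough (dirder I x d <= 0) by lra.
apply (dirder_lub I x d HI); intros r (t & Ht & ->).
assert (I (lc 1 x t d) <= I x) by (apply Rnot_lt_le; intro; apply Hno; eauto).
apply Rmult_le_reg_l with t; [easy|].
replace (t * ((I (lc 1 x t d) - I x) / t)) with (I (lc 1 x t d) - I x) by (field; lra). lra.
Qed.

Lemma dirder_above_inf I x : concave_niveloid I -> above_inf (dirder I x).
Proof.
intros HI d m Hm.
pose proof (dirder_ge I x d 1 HI ltac:(lra)).
assert (I x <= I (lc 1 x 1 d) + - m); [|lra].
apply niveloid_le; [easy|]; intro n; simpl; specialize (Hm n); lra.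
Qed.

(** Quotients with steps [t] and [t'] are merged into one with step [/ k], where
    [k = a / t + b / t']; concavity of [I] then gives the inequality. *)
Lemma dirder_superlinear I x : concave_niveloid I -> superlinear (dirder I x).
Proof.
intros HI; apply superlinear_Sup.
- intro d; exists ((I (lc 1 x 1 d) - I x) / 1), 1; split; [lra|easy].
- intro d; exists (dirder I x d); apply dirder_lub, HI.
- intros a b d e r s Ha Hb (t & Ht & ->) (t' & Ht' & ->).
  destruct (Rle_lt_or_eq_dec 0 (a / t + b / t')) as [Hk|Hk].
  { apply Rplus_le_le_0_compat; apply Rle_mult_inv_pos; easy. }
  + (* [x + (a d + b e) / k] is the convex combination of [x + t d] and [x + t' e]
       with weights [a / (t k)] and [b / (t' k)]. *)
    set (k := a / t + b / t') in *.
    exists ((I (lc 1 x (/ k) (lc a d b e)) - I x) / (/ k)); split.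
    { exists (/ k); split; [now apply Rinv_0_lt_compat|easy]. }
    assert (H : (a / t / k) * I (lc 1 x t d) + (b / t' / k) * I (lc 1 x t' e)
                <= I (lc 1 x (/ k) (lc a d b e))).
    { apply niveloid_concave; auto.
      - apply Rle_mult_inv_pos; [apply Rle_mult_inv_pos|]; easy.
      - apply Rle_mult_inv_pos; [apply Rle_mult_inv_pos|]; easy.
      - transitivity (k / k); [unfold k at 3; field|field]; repeat split; lra.
      - intro n; simpl.
        transitivity ((a / t + b / t') / k * x n + (a / k * d n + b / k * e n)).
        + fold k; field; lra.
        + field; repeat split; lra. }
    apply Rmult_le_compat_l with (r := k) in H; [|lra].
    replace ((I (lc 1 x (/ k) (lc a d b e)) - I x) / / k)
      with (k * I (lc 1 x (/ k) (lc a d b e)) - k * I x) by (field; lra).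
    replace (k * I x) with (a / t * I x + b / t' * I x) by (unfold k; ring).
    replace (k * (a / t / k * I (lc 1 x t d) + b / t' / k * I (lc 1 x t' e)))
      with (a / t * I (lc 1 x t d) + b / t' * I (lc 1 x t' e)) in H by (field; repeat split; lra).
    unfold Rdiv in *; lra.
  (* Here [a / t + b / t' = 0], so [a = b = 0] and a zero quotient suffices. *)
  + assert (0 <= a / t) by (apply Rle_mult_inv_pos; easy).
    assert (0 <= b / t') by (apply Rle_mult_inv_pos; easy).
    exists ((I (lc 1 x 1 (lc a d b e)) - I x) / 1); split; [exists 1; split; [lra|easy]|].
    assert (a = 0) by (replace a with (a / t * t) by (field; lra); replace (a / t) with 0 by lra; ring).
    assert (b = 0) by (replace b with (b / t' * t') by (field; lra); replace (b / t') with 0 by lra; ring).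
    subst a b; replace (lc 1 x 1 (lc 0 d 0 e)) with x by linf_eq.
    unfold Rdiv; lra.
Qed.

(** A strictly positive derivative yields an actual improvement [I x < I (x + t d)], to which
    [improving] applies. The boundary case is reached by adding a small constant to [d]. *)
Lemma dirder_improving T I x d :
  linear_map T -> concave_niveloid I -> improving T I ->
  0 <= dirder I x d -> 0 <= dirder I x (T d).
Proof.
intros HT HI HTI Hd.
pose proof (dirder_superlinear I x HI) as Hs.
pose proof (dirder_above_inf I x HI) as Hinf.
assert (Hpos : forall e, 0 < dirder I x e -> 0 <= dirder I x (T e)).
{ intros e He; destruct (dirder_pos I x e HI He) as (t & Ht & Hlt).
  specialize (HTI x (lc t e 0 e)).
  replace (ladd x (lc t e 0 e)) with (lc 1 x t e) in HTI by linf_eq.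
  replace (ladd x (T (lc t e 0 e))) with (lc 1 x t (T e)) in HTI
    by (rewrite linear_map_lc by easy; linf_eq).
  pose proof (dirder_ge I x (T e) t HI Ht).
  apply Rmult_le_reg_l with t; [easy|]; lra. }
destruct (linf_bound (T (cst 1))) as (M & HM & HTM).
apply Rnot_lt_le; intro Hneg.
(* Chosen so that the perturbation [eps * T 1] costs at most half of the supposed deficit. *)
set (eps := - dirder I x (T d) / (2 * M)).
assert (Heps : 0 < eps) by (apply Rdiv_lt_0_compat; lra).
assert (H1 : 1 * dirder I x d + eps * dirder I x (cst 1) <= dirder I x (lc 1 d eps (cst 1))).
{ apply superlinear_le; auto; lra. }
assert (H2 : 1 <= dirder I x (cst 1)) by (apply Hinf; intro n; simpl; lra).
assert (H3 : 0 <= dirder I x (T (lc 1 d eps (cst 1)))) by (apply Hpos; nra).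
assert (H4 : 1 * dirder I x (T (lc 1 d eps (cst 1)))
             + eps * dirder I x (lc (-1) (T (cst 1)) 0 d) <= dirder I x (T d)).
{ apply superlinear_le; auto; try lra; intro n; simpl; rewrite HT; ring. }
assert (H5 : - M <= dirder I x (lc (-1) (T (cst 1)) 0 d)).
{ apply Hinf; intro n; simpl; specialize (HTM n); lra. }
apply Rmult_le_compat_l with (r := eps) in H5; [|lra].
replace (eps * - M) with (dirder I x (T d) / 2) in H5 by (unfold eps; field; lra). lra.
Qed.

(** Applying [above_inf] to differences gives a sup norm estimate, hence continuity; the constants 1
    and -1 give the normalization. *)
Lemma linear_above_inf_Delta p : linear_fun p -> above_inf p -> in_Delta p.
Proof.
intros Hp Hinf.
assert (Hle : forall (x y : linf) e, (forall n, Rabs (y n - x n) <= e) -> p y - p x <= e).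
{ intros x y e H.
  assert (H' : - e <= p (lc 1 x (-1) y)).
  { apply Hinf; intro n; simpl; specialize (H n).
    pose proof (Rle_abs (y n - x n)); lra. }
  rewrite Hp in H'; lra. }
split; [split; [easy|]|split].
- intros x eps Heps; exists eps; split; [easy|]; intros y Hy.
  apply Rabs_le; split; [|now apply Hle].
  enough (p x - p y <= eps) by lra.
  apply Hle; intro n; rewrite Rabs_minus_sym; apply Hy.
- intro A; apply Hinf; intro n; simpl; destruct (A n); lra.
- apply Rle_antisym; [|apply Hinf; intro; simpl; lra].
  set (one := ind (fun _ => true)).
  enough (- 1 <= p (lc (-1) one 0 one)) by (rewrite Hp in *; lra).
  apply Hinf; intro n; simpl; lra.
Qed.

(** Vanishing on the range of [T - l] is the eigenvector equation, and domination of the derivative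
    in the direction [y - x], with step 1, is the supergradient inequality. *)
Lemma niveloid_eigen_supergradient T I x :
  linear_map T -> concave_niveloid I -> improving T I ->
  exists p, DeltaT T p /\ forall y, I y - p y <= I x - p x.
Proof.
intros HT HI HTI.
pose proof (dirder_superlinear I x HI) as Hs.
pose proof (dirder_above_inf I x HI) as Hinf.
destruct (superlinear_eigenvalue T (dirder I x)) as [l Hl]; auto.
{ intro d; now apply dirder_improving. }
destruct (hahn_banach_annihilator (dirder I x) (fun d => lc 1 (T d) (- l) d))
  as (p & Hp & Hle & Hker); auto.
{ intros a b u v n; simpl; rewrite HT; ring. }
assert (HD : in_Delta p).
{ apply linear_above_inf_Delta; [easy|]; intros d m Hd.
  apply Rle_trans with (dirder I x d); auto. }
exists p; split; [split; [easy|]|].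
- split; [apply HD|]; split.
  + exists (ind (fun _ => true)); rewrite (proj2 (proj2 HD)); lra.
  + exists l; intro d; specialize (Hker d); rewrite Hp in Hker; unfold adj; lra.
- intro y; pose proof (dirder_ge I x (lc 1 y (-1) x) 1 HI ltac:(lra)) as H.
  replace (lc 1 x 1 (lc 1 y (-1) x)) with y in H by linf_eq.
  specialize (Hle (lc 1 y (-1) x)); rewrite Hp in Hle; lra.
Qed.

(** * Preferences and their constant equivalents *)

(** Connectedness of the unit interval: the supremum of [B] lies in [B], and it is 1 or a limit of
    points of [A] from the right. *)
Lemma closed_cover_meet (A B : R -> Prop) :
  closed_set A -> closed_set B -> (forall a, B a -> 0 <= a <= 1) ->
  (forall a, 0 <= a <= 1 -> A a \/ B a) -> A 1 -> B 0 -> exists u, A u /\ B u.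
Proof.
intros HA HB HB01 Hcov HA1 HB0.
destruct (completeness B) as [u [Hub Hlub]].
{ exists 1; intros b Hb; apply HB01, Hb. }
{ now exists 0. }
assert (HBu : B u).
{ apply NNPP; intro Hu; destruct (HB u Hu) as [[delta Hdelta] Hd]; simpl in Hd.
  enough (u <= u - delta) by lra.
  apply Hlub; intros b Hb; apply Rnot_lt_le; intro Hb'.
  apply (Hd b); [|easy]; unfold disc; simpl.
  specialize (Hub b Hb); rewrite Rabs_left1; lra. }
exists u; split; [|easy].
apply NNPP; intro Hu; destruct (HA u Hu) as [[delta Hdelta] Hd]; simpl in Hd.
assert (u < 1).
{ destruct (HB01 u HBu) as [_ [Hlt|He]]; [easy|]. subst u; now destruct Hu. }
set (v := u + Rmin delta (1 - u) / 2).
assert (Hv : u < v /\ v < u + delta /\ v <= 1).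
{ unfold v; pose proof (Rmin_l delta (1 - u)); pose proof (Rmin_r delta (1 - u)).
  assert (0 < Rmin delta (1 - u)) by (apply Rmin_glb_lt; lra). lra. }
specialize (HB01 u HBu).
destruct (Hcov v ltac:(lra)) as [HAv|HBv].
- apply (Hd v); [|easy]; unfold disc; simpl; rewrite Rabs_right; lra.
- specialize (Hub v HBv); lra.
Qed.

(** If [s < t], ICRP gives that 0 is weakly preferred to [d = t - s], and iterating, to every [n d];
    once [n d > 1] this contradicts that 1 is strictly preferred to 0. *)
Lemma constants_strict pref s t :
  weak_order pref -> monotonicity pref -> icrp pref ->
  pref (cst s) (cst t) -> t <= s.
Proof.
intros [Htot Htrans] [Hmon [_ H10]] Hicrp H; apply Rnot_lt_le; intro Hst.
set (d := t - s); assert (Hd : 0 < d) by (unfold d; lra).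
assert (H0d : pref (cst 0) (cst d)).
{ specialize (Hicrp _ _ (- s) H).
  replace (cst 0) with (ladd (cst s) (cst (- s))) by linf_eq.
  replace (cst d) with (ladd (cst t) (cst (- s))) by (unfold d; linf_eq). easy. }
assert (Hn : forall n, pref (cst 0) (cst (INR n * d))).
{ induction n as [|n IH].
  - apply Hmon; intro k; simpl; lra.
  - apply Htrans with (cst d); [easy|].
    specialize (Hicrp _ _ d IH).
    replace (cst d) with (ladd (cst 0) (cst d)) by linf_eq.
    replace (cst (INR (S n) * d)) with (ladd (cst (INR n * d)) (cst d)); [easy|].
    rewrite S_INR; linf_eq. }
destruct (archimed_nat d 1 Hd) as [n Hn1].
apply H10, Htrans with (cst (INR n * d)); [easy|].
apply Hmon; intro k; simpl; lra.
Qed.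

(** The segment from [- M] to [M] consists of constants; its parts above and below [x] are closed
    and cover it, so they meet. *)
Lemma constant_equivalent_exists pref x :
  weak_order pref -> monotonicity pref -> continuity pref ->
  exists t, pref x (cst t) /\ pref (cst t) x.
Proof.
intros [Htot Htrans] [Hmon _] Hcont.
destruct (linf_bound x) as (M & HM & Hx).
assert (Hup : pref (cst M) x) by (apply Hmon; intro n; apply Hx).
assert (Hlo : pref x (cst (- M))) by (apply Hmon; intro n; apply Hx).
destruct (Hcont _ _ _ Hup Hlo) as [HA HB].
destruct (closed_cover_meet _ _ HA HB) as (u & [Hu HAu] & [_ HBu]).
- easy.
- intros a Ha; destruct (Htot (lc a (cst M) (1 - a) (cst (- M))) x); tauto.
- split; [lra|]; replace (lc 1 (cst M) (1 - 1) (cst (- M))) with (cst M) by linf_eq; easy.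
- split; [lra|]; replace (lc 0 (cst M) (1 - 0) (cst (- M))) with (cst (- M)) by linf_eq; easy.
- exists (u * M + (1 - u) * - M).
  replace (cst (u * M + (1 - u) * - M)) with (lc u (cst M) (1 - u) (cst (- M))) by linf_eq.
  easy.
Qed.

Lemma axioms_niveloid T pref :
  all_axioms T pref ->
  exists I, const_equiv pref I /\ concave_niveloid I /\ improving T I.
Proof.
intros (Hwo & Hmono & Hcont & Hicrp & Hconv & Hitis).
destruct (boolp.choice (fun x => constant_equivalent_exists pref x Hwo Hmono Hcont)) as [I HI].
pose proof (fun s t => constants_strict pref s t Hwo Hmono Hicrp) as Hstrict.
destruct Hwo as [Htot Htrans], Hmono as [Hmon _].
assert (Hrep : forall x y, pref x y <-> I x >= I y).
{ intros x y; destruct (HI x) as [Hx Hx'], (HI y) as [Hy Hy']; split; intro H.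
  - apply Rle_ge, Hstrict; eauto.
  - apply Htrans with (cst (I x)); [easy|]; apply Htrans with (cst (I y)); [|easy].
    apply Hmon; intro n; simpl; lra. }
assert (HIc : forall t, I (cst t) = t).
{ intro t; destruct (HI (cst t)); apply Rle_antisym; now apply Hstrict. }
assert (Htr : forall x t, I (ladd x (cst t)) = I x + t).
{ intros x t; destruct (HI x) as [Hx Hx'].
  apply (Hicrp _ _ t) in Hx; apply (Hicrp _ _ t) in Hx'.
  replace (ladd (cst (I x)) (cst t)) with (cst (I x + t)) in * by linf_eq.
  rewrite Hrep, HIc in *; lra. }
exists I; split; [easy|]; split.
- split; [intros x y H; apply Rge_le, Hrep, Hmon, H|]; split; [easy|].
  intros l x y Hl.
  (* Convexity only compares with a common constant, so [x] and [y] are first shifted to level 0;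
     translation invariance undoes the shift. *)
  assert (Hz : forall z, pref (ladd z (cst (- I z))) (cst 0)).
  { intro z; apply Hrep; rewrite Htr, HIc; lra. }
  pose proof (Hconv _ _ 0 l (Hz x) (Hz y) Hl) as H.
  replace (lc l (ladd x (cst (- I x))) (1 - l) (ladd y (cst (- I y))))
    with (ladd (lc l x (1 - l) y) (cst (- (l * I x + (1 - l) * I y)))) in H by linf_eq.
  rewrite Hrep, Htr, HIc in H; lra.
- intros x d H; apply Rge_le, Hrep, Hitis, Hrep; lra.
Qed.

(** * The axioms recovered from a concave niveloid *)

Lemma niveloid_segment_lipschitz I x z :
  concave_niveloid I -> exists L, 0 < L /\
    forall a b, Rabs (I (lc a x (1 - a) z) - I (lc b x (1 - b) z)) <= L * Rabs (a - b).
Proof.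
intro HI; destruct (linf_bound (lc 1 x (-1) z)) as (L & HL & HxL); exists L; split; [easy|].
assert (Hle : forall a b, I (lc a x (1 - a) z) <= I (lc b x (1 - b) z) + L * Rabs (a - b)).
{ intros a b; apply niveloid_le; [easy|]; intro n; simpl.
  specialize (HxL n); simpl in HxL; unfold Rabs; destruct (Rcase_abs (a - b)); nra. }
intros a b; pose proof (Hle a b); pose proof (Hle b a).
rewrite (Rabs_minus_sym b a) in *; apply Rabs_le; lra.
Qed.

(** Closedness is in the whole line, so points outside the unit interval are separated first;
    inside, [(k - f a) / L] is a safe radius. *)
Lemma closed_set_lipschitz_ge f L k :
  0 < L -> (forall a b, Rabs (f a - f b) <= L * Rabs (a - b)) ->
  closed_set (fun a => 0 <= a <= 1 /\ k <= f a).
Proof.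
intros HL Hf a Ha; unfold complementary in Ha.
assert (Hopen : forall r, 0 < r -> (forall b, Rabs (b - a) < r -> ~ (0 <= b <= 1 /\ k <= f b)) ->
  neighbourhood (complementary (fun a => 0 <= a <= 1 /\ k <= f a)) a).
{ intros r Hr H; exists (mkposreal r Hr); intros b Hb; now apply H. }
destruct (Rlt_dec a 0) as [Ha0|Ha0]; [|destruct (Rlt_dec 1 a) as [Ha1|Ha1]].
- apply (Hopen (- a)); [lra|]; intros b Hb [Hb01 _]; apply Rabs_def2 in Hb; lra.
- apply (Hopen (a - 1)); [lra|]; intros b Hb [Hb01 _]; apply Rabs_def2 in Hb; lra.
- assert (Hk : f a < k) by (apply Rnot_le_lt; intro; apply Ha; lra).
  apply (Hopen ((k - f a) / L)); [apply Rdiv_lt_0_compat; lra|].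
  intros b Hb [_ Hkb]; specialize (Hf b a); pose proof (Rle_abs (f b - f a)).
  apply Rmult_lt_compat_l with (r := L) in Hb; [|easy].
  replace (L * ((k - f a) / L)) with (k - f a) in Hb by (field; lra). lra.
Qed.

(** Translation leaves only [I 0] to find; 0 is equivalent to the constant [I 0], whose value is
    [2 * I 0], so [I 0 = 0]. *)
Lemma const_equiv_niveloid_cst pref I :
  const_equiv pref I -> concave_niveloid I -> forall t, I (cst t) = t.
Proof.
intros [HI Hrep] (_ & Htr & _).
assert (Hshift : forall t, I (cst t) = I (cst 0) + t).
{ intro t; rewrite <- Htr; f_equal; linf_eq. }
pose proof (Hshift (I (cst 0))) as H0; destruct (HI (cst 0)) as [H1 H2].
rewrite Hrep in H1, H2; intro t; rewrite Hshift; lra.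
Qed.

Lemma niveloid_axioms T pref I :
  const_equiv pref I -> concave_niveloid I -> improving T I -> all_axioms T pref.
Proof.
intros [HI Hrep] HN HT; pose proof HN as (Hmon & Htr & Hconc).
pose proof (const_equiv_niveloid_cst pref I (conj HI Hrep) HN) as HIc.
split; [|split; [|split; [|split; [|split]]]].
- split; intros *; rewrite ?Hrep; lra.
- split; [intros x y H; apply Hrep; specialize (Hmon _ _ H); lra|].
  rewrite !Hrep, !HIc; lra.
- intros x y z _ _.
  destruct (niveloid_segment_lipschitz I x z HN) as (L & HL & Hlip).
  assert (Hiff : forall A B : R -> Prop, (forall a, A a <-> B a) -> closed_set A -> closed_set B).
  { intros A B HAB HA a Ha.
    destruct (HA a) as [r Hr]; [intro H; apply Ha, HAB, H|].
    exists r; intros b Hb H; apply (Hr b Hb), HAB, H. }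
  split.
  + apply (Hiff (fun a => 0 <= a <= 1 /\ I y <= I (lc a x (1 - a) z))).
    { intro a; rewrite Hrep; lra. }
    now apply closed_set_lipschitz_ge with L.
  + apply (Hiff (fun a => 0 <= a <= 1 /\ - I y <= - I (lc a x (1 - a) z))).
    { intro a; rewrite Hrep; lra. }
    apply closed_set_lipschitz_ge with L; [easy|]; intros a b.
    replace (- I (lc a x (1 - a) z) - - I (lc b x (1 - b) z))
      with (- (I (lc a x (1 - a) z) - I (lc b x (1 - b) z))) by ring.
    rewrite Rabs_Ropp; apply Hlip.
- intros x y t; rewrite !Hrep, !Htr; lra.
- intros x y t l; rewrite !Hrep, HIc; intros Hx Hy Hl.
  specialize (Hconc l x y Hl); nra.
- intros x d; rewrite !Hrep; intro H; apply Rle_ge, HT; lra.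
Qed.

(** * Variational representations *)

(** The concave conjugate up to sign: the least cost with [I x <= p x + c p] for all [x]. *)
Definition conj_cost (I : linf -> R) (p : linf -> R) : Rbar :=
  Lub_Rbar (fun r => exists x, r = I x - p x).

Lemma conj_cost_ge I p x : Rbar_le (I x - p x) (conj_cost I p).
Proof. apply (Lub_Rbar_correct _); now exists x. Qed.

(** At a supergradient the cost is finite and [p] attains the minimum defining [I x]. *)
Lemma conj_cost_attained I p x :
  (forall y, I y - p y <= I x - p x) -> conj_cost I p = I x - p x.
Proof.
intro H; apply is_lub_Rbar_unique; split.
- intros r (y & ->); apply H.
- intros b Hb; apply Hb; now exists x.
Qed.

(** A supremum of functions continuous in [p]: one [x] with [I x - p x > t] already determines the
    neighbourhood. *)
Lemma conj_cost_wlsc T I : wlsc_on T (conj_cost I).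
Proof.
intros p _ t Ht.
assert (exists x, t < I x - p x) as [x Hx].
{ apply NNPP; intro Hno.
  assert (H : Rbar_le (conj_cost I p) t).
  { apply (Lub_Rbar_correct _); intros r (x & ->); apply Rnot_lt_le; intro; apply Hno; eauto. }
  now apply Rbar_le_not_lt in H. }
exists (cons x nil), (I x - p x - t); split; [lra|].
intros q _ Hq; inversion_clear Hq as [|? ? H _]; apply Rabs_def2 in H.
apply Rbar_lt_le_trans with (I x - q x); [simpl; lra|apply conj_cost_ge].
Qed.

Lemma niveloid_representation T I :
  linear_map T -> concave_niveloid I -> improving T I -> I (cst 0) = 0 ->
  nonneg_on T (conj_cost I) /\ grounded T (conj_cost I) /\ min_rep T (conj_cost I) I.
Proof.
intros HT HN HTI HI0.
assert (H0 : forall p, DeltaT T p -> p (cst 0) = 0).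
{ intros p [[[Hp _] _] _]; replace (cst 0) with (lc 0 (cst 0) 0 (cst 0)) by linf_eq.
  rewrite Hp; ring. }
assert (Hnn : nonneg_on T (conj_cost I)).
{ intros p Hp; replace 0 with (I (cst 0) - p (cst 0)) by (rewrite (H0 p Hp); lra).
  apply conj_cost_ge. }
split; [easy|]; split; [split; [easy|]|].
(* A supergradient at 0 has cost exactly 0. *)
- intros eps Heps.
  destruct (niveloid_eigen_supergradient T I (cst 0)) as (p & Hp & Hmax); auto.
  exists p; split; [easy|].
  rewrite (conj_cost_attained I p (cst 0)), (H0 p Hp), HI0 by easy; simpl; lra.
- intro x; split.
  + destruct (niveloid_eigen_supergradient T I x) as (p & Hp & Hmax); auto.
    exists p; split; [easy|]; rewrite (conj_cost_attained I p x) by easy.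
    simpl; f_equal; ring.
  + intros p Hp; pose proof (conj_cost_ge I p x) as H; specialize (Hnn p Hp).
    destruct (conj_cost I p); simpl in *; lra.
Qed.

(* Halving the range: subtracting [M/2] times the indicator of [x > M/2] from [x]
   leaves a sequence with values in [[0, M/2]]. *)
Lemma Delta_bisect p (x : linf) M n :
  in_Delta p -> (forall k, 0 <= x k <= M) ->
  exists y : linf, (forall k, 0 <= y k <= M / 2 ^ n) /\ p y <= p x.
Proof.
intros [[Hlin _] [Hpos _]] Hx; induction n as [|n (y & Hy & Hle)].
- exists x; split; [|lra]; intro k; specialize (Hx k); simpl; lra.
- set (h := M / 2 ^ S n).
  assert (Hh : M / 2 ^ n = h + h) by (unfold h; simpl; field; apply pow_nonzero; lra).
  set (A := fun k => if Rlt_dec h (y k) then true else false).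
  exists (lc 1 y (- h) (ind A)); split.
  + intro k; specialize (Hy k); simpl; unfold A; destruct (Rlt_dec h (y k)); lra.
  (* The coordinate 0 of [y] only serves to show [0 <= h]. *)
  + rewrite Hlin; specialize (Hpos A); specialize (Hy O); nra.
Qed.

(** [in_Delta] gives positivity on indicators only. Bisection produces a [y] within [delta] of 0
    with [p y <= p x], so a negative [p x] would contradict continuity at 0. *)
Lemma Delta_nonneg p (x : linf) : in_Delta p -> (forall k, 0 <= x k) -> 0 <= p x.
Proof.
intros Hp Hx; apply Rnot_lt_le; intro Hneg.
destruct (proj2 (proj1 Hp) (cst 0) (- p x / 2) ltac:(lra)) as (delta & Hdelta & Hcont).
assert (H0 : p (cst 0) = 0).
{ replace (cst 0) with (lc 0 (cst 0) 0 (cst 0)) by linf_eq.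
  rewrite (proj1 (proj1 Hp)); ring. }
destruct (linf_bound x) as (M & HM & HxM).
destruct (Pow_x_infinity 2 ltac:(rewrite Rabs_right; lra) (M / delta)) as [n Hn].
specialize (Hn n (le_n n)).
destruct (Delta_bisect p x M n Hp) as (y & Hy & Hle).
{ intro k; split; [easy|apply HxM]. }
assert (H2 : 0 < 2 ^ n) by (apply pow_lt; lra).
rewrite (Rabs_right (2 ^ n)) in Hn by lra.
assert (Hsmall : M / 2 ^ n <= delta).
{ apply Rmult_le_reg_r with (2 ^ n); [easy|].
  apply Rge_le, (Rmult_le_compat_l delta) in Hn; [|lra].
  replace (delta * (M / delta)) with M in Hn by (field; lra).
  replace (M / 2 ^ n * 2 ^ n) with M by (field; lra). lra. }
specialize (Hcont y); rewrite H0 in Hcont.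
assert (H : Rabs (p y - 0) <= - p x / 2).
{ apply Hcont; intro k; simpl; specialize (Hy k); rewrite Rabs_right; lra. }
pose proof (Rle_abs (- (p y - 0))); rewrite Rabs_Ropp in *; lra.
Qed.

Lemma representation_niveloid T c I :
  positive_map T ->
  min_rep T c I -> (forall p, DeltaT T p -> adj T p (cst 1) <= 1) ->
  concave_niveloid I /\ improving T I.
Proof.
intros HTpos Hmin H1.
(* The minimizer for [x] is tested at [y]; its cost is finite because the minimum is. *)
assert (Hle : forall x y k, (forall p, DeltaT T p -> p y <= p x + k) -> I y <= I x + k).
{ intros x y k H; destruct (Hmin x) as [(p & Hp & Hx) _], (Hmin y) as [_ Hy].
  specialize (Hy p Hp); specialize (H p Hp).
  destruct (c p); simpl in *; try easy; injection Hx; lra. }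
assert (Hone : forall p, DeltaT T p -> forall t, p (cst t) = t).
{ intros p [[[Hlin _] [_ Hp1]] _] t.
  replace (cst t) with (lc t (ind (fun _ => true)) 0 (cst 0)) by linf_eq.
  rewrite Hlin, Hp1; ring. }
split; [split; [|split]|].
- intros x y H; rewrite <- Rplus_0_r; apply Hle; intros p [Hp _].
  assert (0 <= p (lc 1 x (-1) y)) by (apply Delta_nonneg; [easy|]; intro k; specialize (H k); simpl; lra).
  rewrite (proj1 (proj1 Hp)) in H0; lra.
- intros x t; apply Rle_antisym.
  + apply Hle; intros p Hp; unfold ladd.
    rewrite (proj1 (proj1 (proj1 Hp))), Hone by easy; lra.
  + enough (I x <= I (ladd x (cst t)) + - t) by lra.
    apply Hle; intros p Hp; unfold ladd.
    rewrite (proj1 (proj1 (proj1 Hp))), Hone by easy; lra.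
- intros l x y Hl; destruct (Hmin (lc l x (1 - l) y)) as [(p & Hp & Hz) _].
  pose proof (proj2 (Hmin x) p Hp) as Hx; pose proof (proj2 (Hmin y) p Hp) as Hy.
  rewrite (proj1 (proj1 (proj1 Hp))) in Hz.
  destruct (c p); simpl in *; try easy; injection Hz; nra.
- intros x d Hd; destruct (Hmin (ladd x (T d))) as [(p & Hp & Hz) _].
  pose proof (proj2 (Hmin x) p Hp) as Hx; pose proof (proj2 (Hmin (ladd x d)) p Hp) as Hxd.
  pose proof Hp as [HD [_ [_ [lam Hlam]]]]; unfold adj in *.
  (* The eigenvalue is [p (T 1)]: nonnegative by positivity of [T], at most 1 by assumption. *)
  assert (Hlam1 : 0 <= lam <= 1).
  { assert (E : lam = p (T (cst 1))) by (rewrite Hlam, (Hone p Hp); ring).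
    rewrite E; split; [|now apply H1].
    apply Delta_nonneg; [easy|]; intro k; apply HTpos; intro j; simpl; lra. }
  unfold ladd in Hz, Hxd; rewrite (proj1 (proj1 HD)) in Hz, Hxd; rewrite Hlam in Hz.
  (* [p (x + T d) + c p] is the [lam]-mixture of [p (x + d) + c p] and [p x + c p]. *)
  destruct (c p); simpl in *; try easy; injection Hz; fold (ladd x d) in *.
  intro E; unfold ladd in *; nra.
Qed.

Theorem theorem2 (T : linf -> linf)
  (HTlin : linear_map T) (HTcont : cont_map T) (HTpos : positive_map T)
  (pref : linf -> linf -> Prop) :
  (all_axioms T pref ->
     exists c : (linf -> R) -> Rbar,
       nonneg_on T c /\ grounded T c /\ wlsc_on T c /\
       exists I : linf -> R, min_rep T c I /\ const_equiv pref I)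
  /\
  ((exists (c : (linf -> R) -> Rbar) (I : linf -> R),
       nonneg_on T c /\ grounded T c /\ wlsc_on T c /\
       min_rep T c I /\ const_equiv pref I) ->
   (forall p, DeltaT T p -> adj T p (cst 1) <= 1) ->
   all_axioms T pref).
Proof.
split.
- intro Hax; destruct (axioms_niveloid T pref Hax) as (I & HI & HN & HTI).
  destruct (niveloid_representation T I) as (Hnn & Hgr & Hmin); auto.
  { now apply const_equiv_niveloid_cst with pref. }
  exists (conj_cost I); split; [easy|]; split; [easy|]; split; [apply conj_cost_wlsc|].
  now exists I.
- intros (c & I & _ & _ & _ & Hmin & HI) H1.
  destruct (representation_niveloid T c I); auto.
  now apply niveloid_axioms with I.
Qed.
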